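(* Let $n\in\mathbb{N}$ (with $n\ge 1$) and let $U$ be an $n\times n$ complex unitary matrix. The following conditions are equivalent. (1) $U\mathcal{D}_nU^*\subseteq\mathcal{B}_n$, i.e. for every diagonal matrix $D\in\mathcal{D}_n$ the matrix $UDU^*$ is principally balanced. (2) For every $1\le r\le n$ and all $I,J\subset[n]$ with $|I|=|J|=r$, one has $|\det U[I,J]|^2=\frac{1}{N_{n,r}}$. (3) For every $1\le r\le n$, $\sqrt{N_{n,r}}\,\left(\bigwedge^r U\right)\in\mathcal{H}_{N_{n,r}}$, i.e. $\sqrt{N_{n,r}}\,\bigwedge^rU$ is a complex Hadamard matrix of order $N_{n,r}$. (4) $n\le 3$ and $\sqrt{n}\,U\in\mathcal{H}_n$.
   Context: Notation: $[n]=\{1,\dots,n\}$ and $N_{n,r}=\binom{n}{r}$. For an $n\times n$ matrix $A$ and $I,J\subset[n]$, $A[I,J]$ is the submatrix with row set $I$ and column set $J$ (indices in increasing order). $\mathcal{D}_n=\{\mathrm{diag}(d_1,\dots,d_n):d_i\in\mathbb{C}\}$ is the algebra of complex diagonal $n\times n$ matrices. An $n\times n$ complex matrix $A$ is principally balanced if for each $1\le r\le n$ all principal minors of order $r$ are equal, i.e. $\det A[I,I]$ does not depend on the choice of $I\subset[n]$ with $|I|=r$; $\mathcal{B}_n$ is the set of all $n\times n$ principally balanced complex matrices. A complex Hadamard matrix of order $m$ is an $m\times m$ complex matrix $H=(h_{ij})$ with $|h_{ij}|=1$ for all $i,j$ and $HH^*=mI_m$; $\mathcal{H}_m$ is the set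 of all of them. The operator $\bigwedge^rU$ on $\bigwedge^r\mathbb{C}^n$ is defined by $(\bigwedge^rU)(v_1\wedge\cdots\wedge v_r)=Uv_1\wedge\cdots\wedge Uv_r$, and it is identified with its $N_{n,r}\times N_{n,r}$ matrix with respect to the orthonormal basis $\{e_{i_1}\wedge\cdots\wedge e_{i_r}: i_1<\cdots<i_r\}$ indexed by $r$-element subsets $I=\{i_1<\cdots<i_r\}$ of $[n]$, where $e_1,\dots,e_n$ is the standard basis of $\mathbb{C}^n$; its $(I,J)$-entry is $\det U[I,J]$. *)

(* Defs.v *)
From HB Require Import structures.
From mathcomp Require Import all_boot all_order all_fingroup all_algebra.

Set Implicit Arguments.
Unset Strict Implicit.
Unset Printing Implicit Defensive.

Import Order.TTheory GRing.Theory Num.Theory.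
Local Open Scope ring_scope.
Local Open Scope sesquilinear_scope.

(* A subset of [n] of size r, as a subtype of {set 'I_n}, so that A[I, J] for  *)
(* |I| = |J| = r is literally an r x r matrix.                                 *)
Definition rsubset (n r : nat) := {I : {set 'I_n} | #|I| == r}.

(* The k-th element of I in increasing order: see rsubset_nth_lt.              *)
Definition rsubset_nth (n r : nat) (I : rsubset n r) (k : 'I_r) : 'I_n :=
  enum_val (cast_ord (esym (eqP (valP I))) k).

Lemma rsubset_nth_lt (n r : nat) (I : rsubset n r) (k l : 'I_r) :
  (k < l)%N -> (rsubset_nth I k < rsubset_nth I l)%N.
Proof.
move=> kl; have szI : size (enum (val I)) = r by rewrite -cardE (eqP (valP I)).
have srt : sorted ltn [seq val x | x <- enum (val I)].
  apply: (subseq_sorted ltn_trans (s2 := [seq val x | x <- enum 'I_n])).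
    by apply: map_subseq; rewrite (enumT 'I_n); exact: filter_subseq.
  by rewrite val_enum_ord iota_ltn_sorted.
have nthE i : val (rsubset_nth I i) = nth 0 [seq val x | x <- enum (val I)] i.
  by have x0 := rsubset_nth I i; rewrite (nth_map x0) ?szI // /rsubset_nth (enum_val_nth x0).
by rewrite !nthE (sorted_ltn_nth ltn_trans) // inE size_map szI.
Qed.

Lemma rsubset_nth_inj (n r : nat) (I : rsubset n r) : injective (rsubset_nth I).
Proof. by move=> k l /enum_val_inj /cast_ord_inj. Qed.

Lemma rsubset_nth_im (n r : nat) (I : rsubset n r) :
  [set rsubset_nth I k | k : 'I_r] = val I.
Proof.
apply/eqP; rewrite eqEcard card_imset; last exact: rsubset_nth_inj.
rewrite card_ord (eqP (valP I)) leqnn andbT.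
by apply/subsetP => _ /imsetP[k _ ->]; exact: enum_valP.
Qed.

Lemma card_rsubset (n r : nat) : #|{: rsubset n r}| = 'C(n, r).
Proof.
by rewrite card_sig -[n in RHS]card_ord -card_draws; apply: eq_card => I; rewrite !inE.
Qed.

(* A fixed enumeration of the r-subsets, indexing the basis of the r-th        *)
(* exterior power.                                                             *)
Definition rsubset_of (n r : nat) (a : 'I_('C(n, r))) : rsubset n r :=
  enum_val (cast_ord (esym (card_rsubset n r)) a).

Lemma rsubset_of_bij (n r : nat) : bijective (@rsubset_of n r).
Proof.
apply: inj_card_bij; last by rewrite card_rsubset card_ord.
by move=> a b /enum_val_inj /cast_ord_inj.
Qed.

Definition submatrix (T : Type) (m n r s : nat) (A : 'M[T]_(m, n))
    (I : rsubset m r) (J : rsubset n s) : 'M[T]_(r, s) :=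
  mxsub (rsubset_nth I) (rsubset_nth J) A.

Section ExteriorPower.
Variable K : comNzRingType.

(* v_1 /\ ... /\ v_r, where v_1, ..., v_r are the columns of V, in coordinates *)
(* with respect to the basis of the e_I = e_(i_1) /\ ... /\ e_(i_r).           *)
Definition wedge (n r : nat) (V : 'M[K]_(n, r)) : 'cV[K]_('C(n, r)) :=
  \col_a \det (rowsub (rsubset_nth (rsubset_of a)) V).

(* The n x r matrix with columns e_(i_1), ..., e_(i_r).                        *)
Definition basis_frame (n r : nat) (I : rsubset n r) : 'M[K]_(n, r) :=
  colsub (rsubset_nth I) 1%:M.

(* The matrix of the r-th exterior power of U in the basis of the e_I: its     *)
(* column of index J is U e_(j_1) /\ ... /\ U e_(j_r).                         *)
Definition exterior_power (n r : nat) (U : 'M[K]_n) : 'M[K]_('C(n, r)) :=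
  \matrix_(a, b) wedge (U *m basis_frame (rsubset_of b)) a ord0.

Lemma wedge_basis (n r : nat) (b : 'I_('C(n, r))) :
  wedge (basis_frame (rsubset_of b)) = delta_mx b ord0.
Proof.
apply/matrixP => a j; rewrite ord1 !mxE eqxx andbT.
have [<-|ab] := eqVneq a b.
  rewrite (_ : rowsub _ _ = 1%:M) ?det1 //; apply/matrixP => k l.
  by rewrite !mxE (inj_eq (@rsubset_nth_inj _ _ _)).
set I := rsubset_of a; set J := rsubset_of b.
have /subsetPn[i iI iJ] : ~~ (val I \subset val J).
  apply: contra ab => sIJ; rewrite -(bij_eq (rsubset_of_bij n r)) -val_eqE.
  by rewrite /= eqEcard sIJ (eqP (valP I)) (eqP (valP J)) leqnn.
move: iI; rewrite -rsubset_nth_im => /imsetP[k _ def_i].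
rewrite (expand_det_row _ k) big1 // => l _; rewrite !mxE -def_i.
case: eqP => [i_l|]; last by rewrite mul0r.
by case/negP: iJ; rewrite i_l -rsubset_nth_im imset_f.
Qed.

Lemma exterior_powerE (n r : nat) (U : 'M[K]_n) (a b : 'I_('C(n, r))) :
  exterior_power r U a b = \det (submatrix U (rsubset_of a) (rsubset_of b)).
Proof.
rewrite !mxE; congr (\det _); apply/matrixP => k l; rewrite !mxE.
rewrite (bigD1 (rsubset_nth (rsubset_of b) l)) //= !mxE eqxx mulr1 big1 ?addr0 //.
by move=> j /negPf jl; rewrite !mxE jl mulr0.
Qed.

Lemma cauchy_binet (n r : nat) (A : 'M[K]_(r, n)) (B : 'M[K]_(n, r)) :
  \det (A *m B) = \sum_(J : rsubset n r)
    \det (colsub (rsubset_nth J) A) * \det (rowsub (rsubset_nth J) B).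
Proof.
have -> : \det (A *m B) = \sum_(f : {ffun 'I_r -> 'I_n})
    (\prod_i A i (f i)) * \det (rowsub f B).
  transitivity (\sum_(f : {ffun 'I_r -> 'I_n}) \sum_(s : 'S_r)
      (\prod_i A i (f i)) * ((-1) ^+ s * \prod_i B (f i) (s i))).
    rewrite exchange_big; apply: eq_bigr => s _.
    transitivity ((-1) ^+ s * \prod_i \sum_j A i j * B j (s i)).
      by congr (_ * _); apply: eq_bigr => i _; rewrite mxE.
    rewrite bigA_distr_bigA big_distrr; apply: eq_bigr => f _ /=.
    by rewrite big_split mulrCA.
  apply: eq_bigr => f _; rewrite -big_distrr; congr (_ * _).
  by apply: eq_bigr => s _; congr (_ * _); apply: eq_bigr => i _; rewrite mxE.
rewrite (bigID (fun f : {ffun 'I_r -> 'I_n} => injectiveb f)) /=.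
rewrite [X in _ + X]big1 ?addr0 => [|f /injectivePn[i [j ij fij]]]; last first.
  by rewrite (determinant_alternate ij) ?mulr0 // => k; rewrite !mxE fij.
rewrite (partition_big (fun f : {ffun 'I_r -> 'I_n} => [set f k | k : 'I_r])
  (fun J => #|J| == r)) /=; last first.
  by move=> f /injectiveP f_inj; rewrite card_imset // card_ord.
rewrite (reindex_omap (val : rsubset n r -> {set 'I_n}) insub) /=; last first.
  by move=> J Jr; rewrite insubT.
apply: eq_big => [J|J _]; first by rewrite valK eqxx (valP J).
transitivity (\sum_(s : 'S_r) (\prod_i A i (rsubset_nth J (s i))) *
    ((-1) ^+ s * \det (rowsub (rsubset_nth J) B))); last first.
  rewrite [\det (colsub _ _)]/determinant big_distrl; apply: eq_bigr => s _ /=.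
  rewrite mulrCA mulrA; congr (_ * _ * _).
  by apply: eq_bigr => i _; rewrite mxE.
rewrite (reindex (fun s : 'S_r => [ffun i => rsubset_nth J (s i)])) /=; last first.
  pose inv (f : {ffun 'I_r -> 'I_n}) (i : 'I_r) :=
    odflt i [pick k | rsubset_nth J k == f i].
  have invK (f : {ffun 'I_r -> 'I_n}) : injectiveb f && ([set f k | k : 'I_r] == val J) ->
      forall i, rsubset_nth J (inv f i) = f i.
    case/andP=> _ /eqP fJ i; rewrite /inv; case: pickP => [k /eqP //|no].
    have: f i \in val J by rewrite -fJ imset_f.
    by rewrite -rsubset_nth_im => /imsetP[k _ fik]; have:= no k; rewrite fik eqxx.
  exists (fun f : {ffun 'I_r -> 'I_n} =>
            if injectiveP (inv f) is ReflectT h then perm h else 1%g).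
    move=> s _; apply/permP => i.
    have inv_s k : inv [ffun i => rsubset_nth J (s i)] k = s k.
      rewrite /inv; case: pickP => [l|/(_ (s k))]; rewrite ffunE ?eqxx //.
      by move/eqP/rsubset_nth_inj.
    case: injectiveP => [h|[]]; first by rewrite permE inv_s.
    by move=> k l; rewrite !inv_s => /perm_inj.
  move=> f fP; apply/ffunP => i; rewrite ffunE.
  case: injectiveP => [h|[]]; first by rewrite permE invK.
  move=> k l kl; have /andP[/injectiveP f_inj _] := fP; apply: f_inj.
  by rewrite -!invK // kl.
apply: eq_big => [s|s _].
  apply/andP; split.
    by apply/injectiveP => k l; rewrite !ffunE => /rsubset_nth_inj /perm_inj.
  rewrite eqEcard; apply/andP; split.
    by apply/subsetP => _ /imsetP[k _ ->]; rewrite ffunE -rsubset_nth_im imset_f.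
  rewrite card_imset ?(eqP (valP J)) ?card_ord //.
  by move=> k l; rewrite !ffunE => /rsubset_nth_inj /perm_inj.
congr (_ * _); first by apply: eq_bigr => i _; rewrite ffunE.
rewrite -det_perm -det_mulmx -row_permE; congr (\det _).
by apply/matrixP => i j; rewrite !mxE ffunE.
Qed.

Lemma exterior_power_wedge (n r : nat) (U : 'M[K]_n) (V : 'M[K]_(n, r)) :
  exterior_power r U *m wedge V = wedge (U *m V).
Proof.
apply/matrixP => a j; rewrite ord1 !mxE {j}.
rewrite (_ : rowsub _ _ = rowsub (rsubset_nth (rsubset_of a)) U *m V); last first.
  by apply/matrixP => k l; rewrite !mxE; apply: eq_bigr => j _; rewrite mxE.
rewrite cauchy_binet (reindex (@rsubset_of n r)); last exact/onW_bij/rsubset_of_bij.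
apply: eq_bigr => b _; rewrite exterior_powerE !mxE; congr (\det _ * _).
by apply/matrixP => k l; rewrite !mxE.
Qed.

End ExteriorPower.

Section ComplexMatrices.
Variable C : numClosedFieldType.

Definition principally_balanced (n : nat) (A : 'M[C]_n) : Prop :=
  forall r : nat, (1 <= r <= n)%N ->
  forall I J : rsubset n r, \det (submatrix A I I) = \det (submatrix A J J).

Definition complex_hadamard (m : nat) (H : 'M[C]_m) : Prop :=
  (forall i j, `|H i j| = 1) /\ H *m H ^t* = m%:R%:M.

End ComplexMatrices.

(* Main.v *)
Require Import Defs.
From mathcomp Require Import all_boot all_order all_algebra.
From mathcomp Require Import reals complex.
From mathcomp Require Import perm ring zify.

Set Implicit Arguments.
Unset Strict Implicit.
Unset Printing Implicit Defensive.

Import Order.TTheory GRing.Theory Num.Theory.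
Local Open Scope ring_scope.
Local Open Scope sesquilinear_scope.

(** Let U be unitary and call its minors flat when all minors of order r have
    squared modulus 1 / 'C(n, r), for each r.

    Balancedness is flatness because of the Cauchy-Binet expansion
    [principal_minor_conj_diag]: the principal minors of U D U^* of index set I
    are polynomials in the entries of D, whose coefficients are the
    |det U[I, J]|^2.  Evaluating at the indicator vector of J isolates one
    coefficient ([principal_minor_conj_indicator]), so that balancedness says
    that |det U[I, J]|^2 does not depend on I.  As the columns of the unitary
    matrix /\^r U have norm 1 ([sum_norm_minors]), the common value can only be
    1 / 'C(n, r).  Flatness is also the unimodularity of the entries of
    sqrt 'C(n, r) /\^r U, the other half of the Hadamard condition being the
    unitarity of /\^r U.

    Flatness excludes n > 3 already through the minors of orders 1 and 2 on three
    rows and two columns ([flat_minors_le3]).  If z_i is the ratio of the two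
    entries of row i, a unit complex number, then the 2 x 2 minors prescribe
    Re (z_i conj z_k) = - 1 / (n - 1) for all pairs of rows.  But the Gram matrix
    of three vectors of the real plane is singular, and for unit vectors with
    common inner product x its determinant is (1 - x)^2 (1 + 2 x)
    ([phases_gram]).  Since x = - 1 / (n - 1) is not 1, it is - 1 / 2, and n = 3.

    Conversely, for n <= 3 every order r is 1, n - 1 or n.  Order 1 is the
    Hadamard hypothesis, order n is |det U| = 1, and the minors of order n - 1
    have the same moduli as the entries of U, since U^* = U^-1 is the adjugate of
    U divided by det U ([norm_codim1_minor]). *)

(** * Minors along arbitrary injections *)

(** Two parametrisations of one index set differ by a permutation, so minors
    may be computed, up to sign, along any convenient injection rather than
    along the increasing enumeration of a subset. *)
Lemma perm_of_image (T : finType) (r : nat) (f g : 'I_r -> T) :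
  injective f -> (forall k, f k \in codom g) ->
  exists s : 'S_r, forall k, f k = g (s k).
Proof.
move=> f_inj fg.
have s_inj : injective (fun k => iinv (fg k)).
  by move=> k l /(congr1 g); rewrite !f_iinv => /f_inj.
by exists (perm s_inj) => k; rewrite permE f_iinv.
Qed.

(** The permutations of the rows and columns contribute only signs. *)
Lemma norm_det_mxsub (C : numDomainType) (m n r : nat) (A : 'M[C]_(m, n))
    (f f' : 'I_r -> 'I_m) (g g' : 'I_r -> 'I_n) :
  injective f -> injective g ->
  (forall k, f k \in codom f') -> (forall k, g k \in codom g') ->
  `|\det (mxsub f g A)| = `|\det (mxsub f' g' A)|.
Proof.
move=> f_inj g_inj /(perm_of_image f_inj)[s fs] /(perm_of_image g_inj)[t gt].
have -> : mxsub f g A = row_perm s (col_perm t (mxsub f' g' A)).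
  by apply/matrixP => k l; rewrite !mxE fs gt.
by rewrite row_permE col_permE !det_mulmx !det_perm !normrM !normr_sign mul1r mulr1.
Qed.

Lemma det_mx22 (K : comNzRingType) (A : 'M[K]_2) :
  \det A = A 0 0 * A 1 1 - A 0 1 * A 1 0.
Proof.
rewrite (expand_det_row _ 0) !big_ord_recl big_ord0 addr0 /cofactor !det_mx11 !mxE.
have -> : lift (0 : 'I_2) (0 : 'I_1) = 1 by apply: val_inj.
have -> : lift (1 : 'I_2) (0 : 'I_1) = 0 by apply: val_inj.
by rewrite /= expr0 expr1 mul1r mulN1r mulrN.
Qed.

(** * Exterior powers and subsets *)

Lemma exterior_powerM (K : comNzRingType) (n r : nat) (A B : 'M[K]_n) :
  exterior_power r (A *m B) = exterior_power r A *m exterior_power r B.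
Proof.
apply/matrixP => a b; rewrite mxE -mulmxA -exterior_power_wedge !mxE.
by apply: eq_bigr => c _; rewrite [X in _ = _ * X]mxE.
Qed.

Lemma exterior_power1 (K : comNzRingType) (n r : nat) :
  exterior_power r (1%:M : 'M[K]_n) = 1%:M.
Proof. by apply/matrixP => a b; rewrite mxE mul1mx wedge_basis !mxE eqxx andbT. Qed.

Lemma rsubset_neq (n r : nat) (I J : rsubset n r) :
  I != J -> exists k, rsubset_nth I k \notin val J.
Proof.
move=> IJ; have /subsetPn[i iI iJ] : ~~ (val I \subset val J).
  apply: contra IJ => sIJ; rewrite -val_eqE /= eqEcard sIJ.
  by rewrite (eqP (valP I)) (eqP (valP J)) leqnn.
by move: iI iJ; rewrite -(rsubset_nth_im I) => /imsetP[k _ ->]; exists k.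
Qed.

(** * Flat minors *)

Section UnitaryMinors.
Variables (C : numClosedFieldType) (n : nat).
Implicit Types U : 'M[C]_n.

Definition flat_minors U : Prop :=
  forall r : nat, (1 <= r <= n)%N -> forall I J : rsubset n r,
    `|\det (submatrix U I J)| ^+ 2 = 1 / 'C(n, r)%:R.

Lemma flat_minors_mxsub U (r : nat) (f g : 'I_r -> 'I_n) :
  flat_minors U -> (1 <= r <= n)%N -> injective f -> injective g ->
  `|\det (mxsub f g U)| ^+ 2 = 1 / 'C(n, r)%:R.
Proof.
move=> flat r_n f_inj g_inj.
have im (h : 'I_r -> 'I_n) : injective h ->
    exists I : rsubset n r, forall k, h k \in codom (rsubset_nth I).
  move=> h_inj; have hr : #|[set h k | k : 'I_r]| == r by rewrite card_imset ?card_ord.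
  pose I : rsubset n r := Sub [set h k | k : 'I_r] hr; exists I => k.
  have: h k \in val I by rewrite SubK imset_f.
  rewrite -rsubset_nth_im => /imsetP[l _ ->].
  exact: codom_f.
have [[I fI] [J gJ]] := (im f f_inj, im g g_inj).
by rewrite (norm_det_mxsub U f_inj g_inj fI gJ) flat.
Qed.

Lemma flat_minors_entry U (i j : 'I_n) :
  flat_minors U -> (0 < n)%N -> `|U i j| ^+ 2 = 1 / n%:R.
Proof.
move=> flat n_gt0.
have := @flat_minors_mxsub U 1 (fun=> i) (fun=> j) flat.
by rewrite det_mx11 mxE bin1; apply=> // k l _; rewrite !ord1.
Qed.

(** * Exterior powers of a unitary matrix *)

Lemma exterior_power_adjoint (r : nat) U :
  exterior_power r (U ^t*) = (exterior_power r U) ^t*.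
Proof.
apply/matrixP => a b; rewrite [RHS]mxE [_^T _ _]mxE !exterior_powerE -det_map_mx -det_tr.
by congr (\det _); apply/matrixP => k l; rewrite !mxE.
Qed.

Lemma exterior_power_unitary (r : nat) U :
  U \is unitarymx -> exterior_power r U \is unitarymx.
Proof.
move=> /unitarymxP U1; apply/unitarymxP.
by rewrite -exterior_power_adjoint -exterior_powerM U1 exterior_power1.
Qed.

(** These are the squared moduli of the entries of a column of the unitary
    matrix exterior_power r U. *)
Lemma sum_norm_minors (r : nat) U (J : rsubset n r) :
  U \is unitarymx -> \sum_(I : rsubset n r) `|\det (submatrix U I J)| ^+ 2 = 1.
Proof.
move=> /(exterior_power_unitary r) /unitarymxP /mulmx1C.
have [inv ofK invK] := rsubset_of_bij n r.
move=> /matrixP /(_ (inv J) (inv J)); rewrite [LHS]mxE [RHS]mxE eqxx mulr1n => <-.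
rewrite (reindex (@rsubset_of n r)); last exact/onW_bij/rsubset_of_bij.
apply: eq_bigr => a _; rewrite [_^t* _ _]mxE [_^T _ _]mxE exterior_powerE.
by rewrite invK normCK mulrC.
Qed.

(** * Principal minors of a diagonal matrix in a rotated basis *)

(** Cauchy-Binet, applied to the product of the rows I of U D and the columns I
    of U^*. *)
Lemma principal_minor_conj_diag (r : nat) U (d : 'rV[C]_n) (I : rsubset n r) :
  \det (submatrix (U *m diag_mx d *m U ^t*) I I) =
  \sum_(J : rsubset n r)
    `|\det (submatrix U I J)| ^+ 2 * \prod_k d 0 (rsubset_nth J k).
Proof.
rewrite /submatrix mxsub_mul cauchy_binet; apply: eq_bigr => J _.
rewrite normCK mulrAC; congr (_ * _); last first.
  rewrite -det_tr -det_map_mx; congr (\det _).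
  by apply/matrixP => k l; rewrite !mxE.
have -> : colsub (rsubset_nth J) (rowsub (rsubset_nth I) (U *m diag_mx d)) =
    mxsub (rsubset_nth I) (rsubset_nth J) U *m
      diag_mx (\row_k d 0 (rsubset_nth J k)).
  by apply/matrixP => k l; rewrite !mul_mx_diag !mxE.
by rewrite det_mulmx det_diag; congr (_ * _); apply: eq_bigr => k _; rewrite mxE.
Qed.

(** Another r-subset K contains an element outside J, where the indicator of J
    vanishes and kills the K-th term of the expansion. *)
Lemma principal_minor_conj_indicator (r : nat) U (I J : rsubset n r) :
  \det (submatrix (U *m diag_mx (\row_j (j \in val J)%:R) *m U ^t*) I I) =
  `|\det (submatrix U I J)| ^+ 2.
Proof.
rewrite principal_minor_conj_diag (bigD1 J) //= [X in _ + X]big1 => [|K KJ].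
  rewrite big1 ?mulr1 ?addr0 // => k _.
  by rewrite mxE -rsubset_nth_im imset_f.
have [k /negPf kJ] := rsubset_neq KJ.
by rewrite (bigD1 k) //= mxE kJ mul0r mulr0.
Qed.

Lemma flat_minors_balanced U : flat_minors U ->
  forall d, principally_balanced (U *m diag_mx d *m U ^t*).
Proof.
move=> flat d r r_n I J; rewrite !principal_minor_conj_diag.
by apply: eq_bigr => K _; rewrite !flat.
Qed.

Lemma balanced_flat_minors U : U \is unitarymx ->
  (forall d, principally_balanced (U *m diag_mx d *m U ^t*)) -> flat_minors U.
Proof.
move=> U1 bal r r_n I J.
have Nr : 'C(n, r)%:R != 0 :> C.
  by rewrite pnatr_eq0 -lt0n bin_gt0; case/andP: r_n.
apply/(canRL (mulfK Nr)); rewrite -[RHS](sum_norm_minors J U1) mulr_natr.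
rewrite -card_rsubset -sumr_const; apply: eq_bigr => K _.
by rewrite -!principal_minor_conj_indicator; exact: bal.
Qed.

(** * Hadamard exterior powers *)

Lemma norm_sqrt_scale (m : nat) (z : C) : (0 < m)%N ->
  (`|sqrtC m%:R * z| = 1) <-> (`|z| ^+ 2 = 1 / m%:R).
Proof.
move=> m_gt0; have m0 : m%:R != 0 :> C by rewrite pnatr_eq0 -lt0n.
have E : `|sqrtC m%:R * z| ^+ 2 = m%:R * `|z| ^+ 2.
  by rewrite -normrX exprMn sqrtCK normrM normr_nat normrX.
split=> [h|h].
  by apply: (mulfI m0); rewrite -E h expr1n mulrC divfK.
apply/eqP; rewrite -sqrp_eq1 ?normr_ge0 //.
by rewrite E h mulrC divfK.
Qed.

(** Unitarity already gives the orthogonality of the rows, so only the moduli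
    of the entries remain to be prescribed. *)
Lemma unitary_hadamardP (m : nat) (V : 'M[C]_m) : (0 < m)%N -> V \is unitarymx ->
  complex_hadamard (sqrtC m%:R *: V) <->
  (forall i j, `|V i j| ^+ 2 = 1 / m%:R).
Proof.
move=> m_gt0 /unitarymxP V1; split=> [[h _] i j|h].
  by apply/(norm_sqrt_scale (V i j) m_gt0); rewrite -[RHS](h i j) mxE.
split=> [i j|]; first by rewrite mxE; apply/(norm_sqrt_scale (V i j) m_gt0).
apply/matrixP => i j.
have -> : (sqrtC m%:R *: V) ^t* = sqrtC m%:R *: V ^t*.
  apply/matrixP => k l; rewrite !mxE rmorphM /=; congr (_ * _).
  by rewrite conj_Creal // ger0_real // sqrtC_ge0 ler0n.
by rewrite -scalemxAl -scalemxAr V1 scalerA -expr2 sqrtCK scale_scalar_mx mulr1.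
Qed.

Lemma flat_minors_hadamardP U : U \is unitarymx ->
  flat_minors U <-> (forall r : nat, (1 <= r <= n)%N ->
    complex_hadamard (sqrtC 'C(n, r)%:R *: exterior_power r U)).
Proof.
move=> U1.
have N r : (1 <= r <= n)%N -> (0 < 'C(n, r))%N by rewrite bin_gt0 => /andP[].
split=> [flat r r_n|had r r_n I J].
  apply/(unitary_hadamardP (N r r_n) (exterior_power_unitary r U1)) => a b.
  by rewrite exterior_powerE flat.
have [inv _ invK] := rsubset_of_bij n r.
rewrite -(invK I) -(invK J) -exterior_powerE; move: (inv I) (inv J).
apply/(unitary_hadamardP (N r r_n) (exterior_power_unitary r U1)); exact: had.
Qed.

(** * Obstruction in dimension at least four *)

(** The singularity of the Gram determinant of three unit vectors of the plane:
    for unit complex numbers with conjugates a', b', c', the parameter t is twice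
    the common inner product.  The identity is purely algebraic, and comes from
    expanding the product of the three expressions for t: two of its eight terms
    are 1, and the six others are squares that pair up into t ^+ 2 - 2. *)
Lemma phases_gram (K : comNzRingType) (a a' b b' c c' t : K) :
  a * a' = 1 -> b * b' = 1 -> c * c' = 1 ->
  a * b' + a' * b = t -> a * c' + a' * c = t -> b * c' + b' * c = t ->
  (t - 2) ^+ 2 * (t + 1) = 0.
Proof.
move=> aa bb cc ab ac bc.
have sq (x x' y y' : K) : x * x' = 1 -> y * y' = 1 -> x * y' + x' * y = t ->
    (x * y') ^+ 2 + (x' * y) ^+ 2 = t ^+ 2 - 2.
  move=> xx yy xy.
  transitivity ((x * y' + x' * y) ^+ 2 - 2 * ((x * x') * (y * y'))); first by ring.
  by rewrite xx yy xy !mulr1.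
suff E : t * t * t = 3 * (t ^+ 2 - 2) + 2.
  transitivity (t * t * t - (3 * (t ^+ 2 - 2) + 2)); first by ring.
  by rewrite E subrr.
transitivity ((a * b' + a' * b) * (a * c' + a' * c) * (b * c' + b' * c)).
  by rewrite ab ac bc.
transitivity (
  (a * c') ^+ 2 * (b * b') + (a' * c) ^+ 2 * (b * b')
  + (a * b') ^+ 2 * (c * c') + (a' * b) ^+ 2 * (c * c')
  + (b * c') ^+ 2 * (a * a') + (b' * c) ^+ 2 * (a * a')
  + 2 * ((a * a') * (b * b') * (c * c'))); first by ring.
rewrite aa bb cc !mulr1 (sq _ _ _ _ aa cc ac) -!addrA.
rewrite (addrA ((a * b') ^+ 2)) (sq _ _ _ _ aa bb ab).
rewrite (addrA ((b * c') ^+ 2)) (sq _ _ _ _ bb cc bc); ring.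
Qed.

(** Three rows and two columns suffice: the phases of the three row ratios would
    be unit vectors of the plane with pairwise inner products - 1 / (n - 1). *)
Lemma flat_minors_le3 U : flat_minors U -> (n <= 3)%N.
Proof.
move=> flat; rewrite leqNgt; apply/negP => n_gt3.
have n0 : n%:R != 0 :> C by rewrite pnatr_eq0; lia.
have n1 : n%:R - 1 != 0 :> C by rewrite subr_eq0 (eqr_nat _ n 1); lia.
pose i0 := Ordinal (ltnW (ltnW (ltnW n_gt3))).
pose i1 := Ordinal (ltnW (ltnW n_gt3)).
pose i2 := Ordinal (ltnW n_gt3).
have entry i j : n%:R * (U i j * (U i j)^*) = 1.
  have n_gt0 : (0 < n)%N by lia.
  by rewrite -normCK (flat_minors_entry i j flat n_gt0) mulrC divfK.
have binC : 'C(n, 2)%:R * 2 = n%:R * (n%:R - 1) :> C.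
  rewrite -[n%:R - 1]/(n%:R - 1%:R) -natrB; last lia.
  by rewrite -!natrM -[X in ('C(n, X) * X)%N]/(2`!) bin_ffact ffactnS ffactn1
    subn1.
have minor i k : i != k ->
    n%:R * (n%:R - 1) * (`|U i i0 * U k i1 - U i i1 * U k i0| ^+ 2) = 2.
  move=> ik; pose f (x y : 'I_n) (t : 'I_2) := if t == 0 then x else y.
  have f_inj x y : x != y -> injective (f x y).
    move=> /negPf xy s t; rewrite /f.
    case: s t => [[|[|//]] hs] [[|[|//]] ht] //= /eqP; last 1 first.
    - by move=> _; exact: val_inj.
    - by move=> _; exact: val_inj.
    - by rewrite xy.
    - by rewrite eq_sym xy.
  have := flat_minors_mxsub flat _ (f_inj i k ik) (f_inj i0 i1 _).
  rewrite det_mx22 !mxE /= => -> //; last lia.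
  rewrite -binC; field.
  by rewrite pnatr_eq0 -lt0n bin_gt0; lia.
(* The entries of U have modulus 1 / sqrt n, so that the factor n makes z i a
   unit complex number; z' i is its conjugate. *)
pose z i := n%:R * (U i i0 * (U i i1)^*).
pose z' i := n%:R * ((U i i0)^* * U i i1).
have zz i : z i * z' i = 1.
  transitivity (n%:R * (U i i0 * (U i i0)^*) * (n%:R * (U i i1 * (U i i1)^*))).
    by rewrite /z /z'; ring.
  by rewrite !entry mulr1.
have zt i k : i != k -> z i * z' k + z' i * z k = - (2 / (n%:R - 1)).
  move/minor; rewrite normCK rmorphB !rmorphM /= => m.
  apply: (mulfI n1).
  have -> : (n%:R - 1) * - (2 / (n%:R - 1)) = - 2 :> C by field.
  have := entry i i0; have := entry i i1; have := entry k i0; have := entry k i1.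
  move: m; rewrite /z /z'.
  set a := U i i0; set b := U i i1; set c := U k i0; set d := U k i1.
  move: n%:R (a^*) (b^*) (c^*) (d^*) => N a' b' c' d' m dd cc bb aa.
  have P1 : (N * (a * a')) * (N * (d * d')) = 1 by rewrite aa dd mulr1.
  have P2 : (N * (b * b')) * (N * (c * c')) = 1 by rewrite bb cc mulr1.
  (* Solve the 2 x 2 minor for its cross terms: scaled by n ^+ 2, their sum is
     z i * z' k + z' i * z k. *)
  transitivity (((N - 1) * (N * (a * a') * (N * (d * d')) + N * (b * b') * (N * (c * c'))))
    - N * (N * (N - 1) * ((a * d - b * c) * (a' * d' - b' * c')))); first by ring.
  rewrite P1 P2 m; ring.
(* With t = - 2 / (n - 1), the factor t - 2 is - 2 n / (n - 1) and the factor
   t + 1 is (n - 3) / (n - 1). *)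
have := phases_gram (zz i0) (zz i1) (zz i2) (zt i0 i1 isT) (zt i0 i2 isT) (zt i1 i2 isT).
move/eqP; rewrite mulf_eq0 expf_eq0 /= => /orP[]/eqP E.
  have : n%:R = 0 :> C; last by move/eqP; rewrite (negPf n0).
  have : - 2 * n%:R = 0 :> C.
    rewrite -(mulr0 (n%:R - 1)) -E; field; exact: n1.
  by move/eqP; rewrite mulf_eq0 oppr_eq0 pnatr_eq0 /= => /eqP.
have : n%:R = 3%:R :> C; last by move/eqP; rewrite eqr_nat => /eqP; lia.
apply/eqP; rewrite -subr_eq0 -(mulr0 (n%:R - 1)) -E; apply/eqP; field; exact: n1.
Qed.

(** * Dimension at most three *)

(** Read off the entries of U^* = U^-1 = (det U)^-1 adj U, where det U has
    modulus 1. *)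
Lemma norm_cofactor_unitary U i j : U \is unitarymx -> `|cofactor U i j| = `|U i j|.
Proof.
move=> U1; have Uu := unitarymx_unit U1.
have detU : `|\det U| = 1.
  apply/eqP; rewrite -sqrp_eq1 ?normr_ge0 // normCK.
  by rewrite -det_map_mx -[X in _ * X]det_tr map_trmx -det_mulmx (unitarymxP U1) det1.
have := invmx_unitary U1; rewrite /invmx Uu => /matrixP/(_ j i).
rewrite !mxE => /(congr1 Num.norm).
by rewrite normrM normfV detU invr1 mul1r norm_conjC.
Qed.

(** A subset of size n - 1 omits a single index i, and is the image of lift i;
    its minors are thus cofactors up to sign. *)
Lemma norm_codim1_minor U (I J : rsubset n n.-1) : (0 < n)%N ->
  U \is unitarymx -> exists i j, `|\det (submatrix U I J)| = `|U i j|.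
Proof.
move=> n_gt0 U1.
have co (K : rsubset n n.-1) : exists i, forall k, rsubset_nth K k \in codom (lift i).
  have /eqP/cards1P[i Ki] : #|~: val K| = 1%N.
    by have := cardsC (val K); rewrite (eqP (valP K)) card_ord; lia.
  exists i => k; have : rsubset_nth K k \in val K by rewrite -rsubset_nth_im imset_f.
  rewrite -[val K]setCK Ki !inE eq_sym => /unlift_some[l -> _].
  exact: codom_f.
have [[i Ii] [j Jj]] := (co I, co J).
exists i, j; rewrite -norm_cofactor_unitary // /cofactor normrM normr_sign mul1r.
rewrite (norm_det_mxsub U (@rsubset_nth_inj _ _ I) (@rsubset_nth_inj _ _ J) Ii Jj).
by congr `|\det _|; apply/matrixP => k l; rewrite !mxE.
Qed.

Lemma flat_minors_of_entries U : (n <= 3)%N -> U \is unitarymx ->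
  (forall i j, `|U i j| ^+ 2 = 1 / n%:R) -> flat_minors U.
Proof.
move=> n3 U1 flat r /andP[r_gt0 r_n] I J.
have [r1|r_neq1] := eqVneq r 1%N.
  by subst r; rewrite det_mx11 mxE flat bin1.
have [rn|r_neqn] := eqVneq r n.
  (* There is a single n-subset, so the sum of squared minors has one term. *)
  subst r; rewrite binn divr1 -[RHS](sum_norm_minors J U1) (bigD1 I) //= big1 ?addr0 //.
  have /fintype_le1P one : (#|{: rsubset n n}| <= 1)%N by rewrite card_rsubset binn.
  by move=> K; rewrite (one K I) eqxx.
have rE : r = n.-1 by lia.
subst r; have [i [j ->]] := norm_codim1_minor I J (leq_trans r_gt0 r_n) U1.
by rewrite flat -subn1 bin_sub ?bin1 //; lia.
Qed.

Lemma flat_minorsP U : (0 < n)%N -> U \is unitarymx ->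
  flat_minors U <-> (n <= 3)%N /\ complex_hadamard (sqrtC n%:R *: U).
Proof.
move=> n_gt0 U1; split=> [flat|[n3 had]].
  split; first exact: flat_minors_le3 flat.
  apply/(unitary_hadamardP n_gt0 U1) => i j.
  exact: flat_minors_entry.
by apply: flat_minors_of_entries => //; apply/(unitary_hadamardP n_gt0 U1).
Qed.

End UnitaryMinors.

Theorem theorem3p1 (R : realType) (n : nat) (U : 'M[R[i]]_n) :
  (1 <= n)%N -> U \is unitarymx ->
  [<-> forall d : 'rV[R[i]]_n, principally_balanced (U *m diag_mx d *m U ^t*);
       forall r : nat, (1 <= r <= n)%N -> forall I J : rsubset n r,
         `|\det (submatrix U I J)| ^+ 2 = 1 / 'C(n, r)%:R;
       forall r : nat, (1 <= r <= n)%N ->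
         complex_hadamard (sqrtC 'C(n, r)%:R *: exterior_power r U);
       (n <= 3)%N /\ complex_hadamard (sqrtC n%:R *: U)].
Proof.
move=> n_gt0 U1; tfae.
- exact: balanced_flat_minors.
- by move/(flat_minors_hadamardP U1).
- by move/(flat_minors_hadamardP U1)/(flat_minorsP n_gt0 U1).
- by move/(flat_minorsP n_gt0 U1)/flat_minors_balanced.
Qed.
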